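(* Let $n \geq 2$. Let $\mathcal{F}$ be a collection of isomorphism classes of indecomposable, finitely presentable $n$-parameter persistence modules. If $\mathcal{F}$ does not contain indecomposables of arbitrarily high pointwise dimension (that is, if there exists $D \in \mathbb{N}$ such that $\dim N(r) \leq D$ for every $N \in \mathcal{F}$ and every $r \in \mathbf{R}^n$), then the set of $\mathcal{F}$-decomposable modules is nowhere dense in the space of finitely presentable $n$-parameter persistence modules with the interleaving distance.
   Context: Fix a field $\mathbb{k}$ and let $\mathbf{vec}$ be the category of finite dimensional $\mathbb{k}$-vector spaces. $\mathbf{R}^n$ is the poset $\mathbb{R}^n$ with the product (componentwise) order, viewed as a category. An $n$-parameter persistence module is a functor $M : \mathbf{R}^n \to \mathbf{vec}$; morphisms are natural transformations. For $i \in \mathbf{R}^n$, let $\mathsf{P}_i : \mathbf{R}^n \to \mathbf{vec}$ be the functor with $\mathsf{P}_i(j) = \mathbb{k}$ if $i \leq j$ and $0$ otherwise, all structure morphisms not forced to be zero being the identity. A module is finitely presentable if it is isomorphic to the cokernel of a morphism $\bigoplus_{j \in J} \mathsf{P}_j \to \bigoplus_{i \in I} \mathsf{P}_i$ with $I, J$ finite multisets of elements of $\mathbf{R}^n$. A module is decomposable if it is isomorphic to $A \oplus B$ with $A, B$ both non-zero; it is indecomposable if it is non-zero and not decomposable. A finitely presentable module is $\mathcal{F}$-decomposable if it is isomorphic to a direct sum of modules whose isomorphism classes belong to $\mathcal{F}$. Interleavings: for $r \in \mathbb{R}$ and $s \in \mathbf{R}^n$, $s + r$ denotes $(s_1+r,\dots,s_n+r)$.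 The shift $M[r]$ is defined by $M[r](s) = M(s+r)$, with the corresponding structure morphisms (and similarly $f[r]$ for morphisms $f$). For $r \geq 0$, $\eta^M_r : M \to M[r]$ is the natural transformation given by the structure morphisms $M(a) \to M(a+r)$. For $\epsilon \geq 0$, an $\epsilon$-interleaving between $M$ and $N$ is a pair of morphisms $f : M \to N[\epsilon]$, $g : N \to M[\epsilon]$ with $g[\epsilon]\circ f = \eta^M_{2\epsilon}$ and $f[\epsilon] \circ g = \eta^N_{2\epsilon}$. The interleaving distance is $d_I(M,N) = \inf\{\epsilon \geq 0 : M \text{ and } N \text{ are } \epsilon\text{-interleaved}\} \in [0,\infty]$. The space of finitely presentable $n$-parameter persistence modules is the set of isomorphism classes of finitely presentable modules $\mathbf{R}^n \to \mathbf{vec}$, with the topology generated by the open balls of $d_I$ (which is an extended metric on this set). A subset is nowhere dense if its closure has empty interior. *)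

(* Defs.v *)
From HB Require Import structures.
From mathcomp Require Import all_boot all_order all_algebra.
From mathcomp Require Import all_classical all_reals all_analysis.

Set Implicit Arguments.
Unset Strict Implicit.
Unset Printing Implicit Defensive.

Import Order.TTheory GRing.Theory Num.Theory.

Local Open Scope classical_set_scope.
Local Open Scope ring_scope.

Section Poset.
Variables (R : realType) (n : nat).
Implicit Types (s t u : 'rV[R]_n) (r : R).

Definition ple s t : bool := [forall i, s 0 i <= t 0 i].

Lemma ple_refl s : ple s s.
Proof. exact/forallP. Qed.

Lemma ple_trans s t u : ple s t -> ple t u -> ple s u.
Proof.
by move=> /forallP st /forallP tu; apply/forallP => i; apply: le_trans (tu i).
Qed.

Definition translate s r : 'rV[R]_n := s + const_mx r.

Lemma ple_translate s t r : ple s t -> ple (translate s r) (translate t r).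
Proof.
by move=> /forallP st; apply/forallP => i; rewrite !mxE lerD2r.
Qed.

End Poset.

(* A functor from the poset R^n to finite dimensional k-vector spaces.
   [ple] is boolean, so [pmor M st] does not depend on the proof [st]. *)
Record pmod (R : realType) (k : fieldType) (n : nat) := PMod {
  pobj :> 'rV[R]_n -> vectType k;
  pmor : forall s t, ple s t -> 'Hom(pobj s, pobj t);
  pmor_id : forall s (h : ple s s), pmor h = \1%VF;
  pmor_comp : forall s t u (st : ple s t) (tu : ple t u) (su : ple s u),
    (pmor tu \o pmor st)%VF = pmor su }.
Arguments pmor {R k n} p {s t}.

Record phom (R : realType) (k : fieldType) (n : nat) (M N : pmod R k n) := PHom {
  phom_at :> forall s, 'Hom(M s, N s);
  phom_nat : forall s t (st : ple s t),
    (phom_at t \o pmor M st)%VF = (pmor N st \o phom_at s)%VF }.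

Section Modules.
Variables (R : realType) (k : fieldType) (n : nat).
Local Notation pmod := (pmod R k n).
Implicit Types (M N A B : pmod) (r e : R).

Definition pmod_iso M N : Prop :=
  exists (f : phom M N) (g : phom N M),
    forall s, (g s \o f s = \1)%VF /\ (f s \o g s = \1)%VF.

Definition pdim M (s : 'rV[R]_n) : nat := \dim {:M s}.

Definition nonzero M : Prop := exists s, pdim M s != 0%N.

Fact pzero_id (s : 'rV[R]_n) (h : ple s s) : (0 : 'End('rV[k]_0)) = \1%VF.
Proof. by apply/lfunP => x; rewrite [LHS]thinmx0 [RHS]thinmx0. Qed.

Fact pzero_comp (s t u : 'rV[R]_n) (st : ple s t) (tu : ple t u)
    (su : ple s u) :
  ((0 : 'End('rV[k]_0)) \o (0 : 'End('rV[k]_0)))%VF = 0.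
Proof. by rewrite comp_lfun0r. Qed.

Definition pzero : pmod :=
  @PMod R k n (fun=> 'rV[k]_0) (fun _ _ _ => 0) pzero_id pzero_comp.

Section DirectSum.
Variables A B : pmod.

Definition dsum_fun s t (st : ple s t) (x : A s * B s) : A t * B t :=
  (pmor A st x.1, pmor B st x.2).

Fact dsum_fun_is_linear s t (st : ple s t) : linear (dsum_fun st).
Proof. by move=> a x y; rewrite /dsum_fun /= !linearP. Qed.

HB.instance Definition _ s t (st : ple s t) :=
  GRing.isLinear.Build k (A s * B s)%type (A t * B t)%type _ (dsum_fun st)
    (dsum_fun_is_linear st).

Definition dsum_map s t (st : ple s t) :
  'Hom((A s * B s)%type, (A t * B t)%type) := linfun (dsum_fun st).

Fact dsum_id s (h : ple s s) : dsum_map h = \1%VF.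
Proof.
by apply/lfunP => -[x y]; rewrite !lfunE /= /dsum_fun !pmor_id !lfunE.
Qed.

Fact dsum_comp s t u (st : ple s t) (tu : ple t u) (su : ple s u) :
  (dsum_map tu \o dsum_map st)%VF = dsum_map su.
Proof.
apply/lfunP => -[x y]; rewrite !lfunE /= !lfunE /= /dsum_fun /=.
by rewrite -!(pmor_comp _ st tu su) !lfunE.
Qed.

Definition dsum : pmod :=
  @PMod R k n (fun s => (A s * B s)%type) dsum_map dsum_id dsum_comp.

End DirectSum.

Definition dsums (l : seq pmod) : pmod := foldr dsum pzero l.

Definition decomposable M : Prop :=
  exists A B, [/\ nonzero A, nonzero B & pmod_iso M (dsum A B)].

Definition indecomposable M : Prop := nonzero M /\ ~ decomposable M.

Section Free.
Variable i : 'rV[R]_n.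

(* Row vectors of length 1 stand for k when i <= j, and of length 0 for the zero
   space otherwise; the 1 x 1 matrix [const_mx 1] is the identity. *)
Definition pfree_map s t (st : ple s t) :
    'Hom('rV[k]_(ple i s), 'rV[k]_(ple i t)) :=
  linfun (mulmxr (const_mx 1 : 'M[k]_(ple i s, ple i t))).

Fact pfree_id s (h : ple s s) : pfree_map h = \1%VF.
Proof.
apply/lfunP => x; rewrite !lfunE /=; move: x.
case: (ple i s) => x; last by rewrite [LHS]thinmx0 [RHS]thinmx0.
by apply/rowP => j; rewrite !mxE big_ord1 mxE mulr1 !ord1.
Qed.

Fact pfree_comp s t u (st : ple s t) (tu : ple t u) (su : ple s u) :
  (pfree_map tu \o pfree_map st)%VF = pfree_map su.
Proof.
apply/lfunP => x; rewrite !lfunE /= !lfunE /= -mulmxA; congr (x *m _).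
have : ple i s -> ple i t by move=> is_; apply: ple_trans st.
case: (ple i s) => [/(_ isT) ->|_]; last by rewrite [LHS]flatmx0 [RHS]flatmx0.
by apply/matrixP => a b; rewrite !mxE big_ord1 !mxE mulr1.
Qed.

Definition pfree : pmod :=
  @PMod R k n (fun j => 'rV[k]_(ple i j)) pfree_map pfree_id pfree_comp.

End Free.

Definition is_cokernel A B M (f : phom A B) (p : phom B M) : Prop :=
  (forall s, (p s \o f s)%VF = 0) /\
  forall N (q : phom B N), (forall s, (q s \o f s)%VF = 0) ->
    exists h : phom M N, (forall s, (h s \o p s)%VF = q s) /\
      forall h' : phom M N, (forall s, (h' s \o p s)%VF = q s) ->
        forall s, h' s = h s.

Definition fin_presentable M : Prop :=
  exists (I J : seq 'rV[R]_n)
    (f : phom (dsums [seq pfree j | j <- J]) (dsums [seq pfree i | i <- I]))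
    (p : phom (dsums [seq pfree i | i <- I]) M), is_cokernel f p.

Section Shift.
Variables (M : pmod) (r : R).

Fact shift_id s (h : ple s s) : pmor M (ple_translate r h) = \1%VF.
Proof. exact: pmor_id. Qed.

Fact shift_comp s t u (st : ple s t) (tu : ple t u) (su : ple s u) :
  (pmor M (ple_translate r tu) \o pmor M (ple_translate r st))%VF =
  pmor M (ple_translate r su).
Proof. exact: pmor_comp. Qed.

Definition pshift : pmod :=
  @PMod R k n (fun s => M (translate s r))
    (fun s t st => pmor M (ple_translate r st)) shift_id shift_comp.

End Shift.

(* The shifts M[e][e] and M[2e] are identified: the component at s of the
   transformation eta_{2e} is the structure morphism from s to (s + e) + e. *)
Definition interleaved e M N : Prop :=
  exists (f : phom M (pshift N e)) (g : phom N (pshift M e)),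
    forall s (h : ple s (translate (translate s e) e)),
      (g (translate s e) \o f s)%VF = pmor M h /\
      (f (translate s e) \o g s)%VF = pmor N h.

Definition dI M N : \bar R :=
  ereal_inf [set e%:E | e in [set e : R | 0 <= e /\ interleaved e M N]].

End Modules.

Section Space.
Variables (R : realType) (k : fieldType) (n : nat).

(* Isomorphism classes of finitely presentable modules. *)
Record fpspace := FPSpace {
  class_of : pmod R k n -> Prop;
  class_ofP : exists2 M, fin_presentable M &
    forall N, class_of N <-> pmod_iso M N }.

Definition representative (C : fpspace) : pmod R k n :=
  proj1_sig (cid2 (class_ofP C)).

Definition class_dI (C D : fpspace) : \bar R :=
  dI (representative C) (representative D).

Definition class_ball (C : fpspace) (r : R) : fpspace -> Prop :=
  fun D => (class_dI C D < r%:E)%E.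

Definition open_balls (U : fpspace -> Prop) : Prop :=
  exists C r, 0 < r /\ U = class_ball C r.

(* Finite direct sums suffice: a finitely presentable module is not the direct
   sum of infinitely many non-zero modules. *)
Definition fam_decomposable (F : fpspace -> Prop) (M : pmod R k n) : Prop :=
  exists l : seq (pmod R k n),
    (forall i, (i < size l)%N ->
       exists2 C, F C & class_of C (nth (pzero R k n) l i)) /\
    pmod_iso M (dsums l).

End Space.

(* [fpspace] quantifies over modules with values in [vectType k], so it lies in
   a universe too large for [set] and [topologicalType]; the few topological
   notions needed are therefore given here for predicates on any [Type]. *)
Section GeneratedTopology.
Variables (T : Type) (B : (T -> Prop) -> Prop).

(* The coarsest topology containing B. *)
Inductive gen_open : (T -> Prop) -> Prop :=
| gen_open_sub U : B U -> gen_open U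
| gen_open_full : gen_open (fun=> True)
| gen_open_inter U V : gen_open U -> gen_open V ->
    gen_open (fun x => U x /\ V x)
| gen_open_union (G : (T -> Prop) -> Prop) :
    (forall U, G U -> gen_open U) -> gen_open (fun x => exists2 U, G U & U x).

Definition gen_closure (A : T -> Prop) : T -> Prop :=
  fun x => forall U, gen_open U -> U x -> exists2 y, U y & A y.

Definition gen_interior (A : T -> Prop) : T -> Prop :=
  fun x => exists U, [/\ gen_open U, U x & forall y, U y -> A y].

Definition nowhere_dense (A : T -> Prop) : Prop :=
  forall x, ~ gen_interior (gen_closure A) x.

End GeneratedTopology.

(* Main.v *)
Require Import Defs.
From HB Require Import structures.
From mathcomp Require Import all_boot all_order all_algebra.
From mathcomp Require Import all_classical all_reals all_analysis.

(* A module M is perturbed to M (+) X, where X is so small that M and M (+) X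
   are interleaved, and X has D + 2 generators on an antichain with the single
   relation "their sum is 0" at a common upper bound p, before everything is
   killed at a later point.  The antichain forces a morphism X -> X[2e] with e
   small to scale each generator, and the relation forces the scalars to agree:
   at p, every such morphism is a multiple of the structure map, which has rank
   at least D + 1.  If M (+) X were e-interleaved with a sum of modules L_i of
   pointwise dimension at most D, the structure map X -> X[2e] at p would be the
   sum of its composites through the L_i; each of them has rank at most D and is
   a multiple of a map of larger rank, hence vanishes, a contradiction. *)

Set Implicit Arguments.
Unset Strict Implicit.
Unset Printing Implicit Defensive.

Import Order.TTheory GRing.Theory Num.Theory.

Local Open Scope ring_scope.

(** * Morphisms of persistence modules and biproducts *)

Section Homs.
Variables (R : realType) (k : fieldType) (n : nat).
Local Notation pmod := (pmod R k n).
Implicit Types (M N P A B : pmod) (s t u : 'rV[R]_n).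

Lemma pmor1 M s (h : ple s s) x : pmor M h x = x.
Proof. by rewrite pmor_id lfunE. Qed.

Lemma pmorK M s t u (st : ple s t) (tu : ple t u) (su : ple s u) x :
  pmor M tu (pmor M st x) = pmor M su x.
Proof. by rewrite -(pmor_comp M st tu su) lfunE. Qed.

Lemma phomE M N (f : phom M N) s t (st : ple s t) x :
  f t (pmor M st x) = pmor N st (f s x).
Proof. by have /lfunP/(_ x) := phom_nat f st; rewrite !lfunE. Qed.

Section MkHom.
Variables (M N : pmod) (f : forall s, M s -> N s).
Hypothesis f_linear : forall s, linear (@f s).
Hypothesis f_nat : forall s t (st : ple s t) x,
  f (pmor M st x) = pmor N st (f x).

Definition mkphom_at s : 'Hom(M s, N s) :=
  linfun (HB.pack_for {linear M s -> N s} (@f s)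
    (GRing.isLinear.Build k (M s) (N s) _ (@f s) (f_linear (s := s)))).

Fact mkphom_atE s x : mkphom_at s x = f x.
Proof. by rewrite lfunE. Qed.

Fact mkphom_nat s t (st : ple s t) :
  (mkphom_at t \o pmor M st)%VF = (pmor N st \o mkphom_at s)%VF.
Proof. by apply/lfunP => x; rewrite !comp_lfunE !mkphom_atE f_nat. Qed.

Definition mkphom : phom M N := PHom mkphom_nat.

Lemma mkphomE s x : mkphom s x = f x.
Proof. exact: mkphom_atE. Qed.

End MkHom.

Fact phom1_nat M s t (st : ple s t) :
  (\1 \o pmor M st)%VF = (pmor M st \o \1)%VF.
Proof. by rewrite comp_lfun1l comp_lfun1r. Qed.
Definition phom1 M : phom M M := PHom (@phom1_nat M).

Fact phom_comp_nat M N P (g : phom N P) (f : phom M N) s t (st : ple s t) :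
  ((g t \o f t) \o pmor M st)%VF = (pmor P st \o (g s \o f s))%VF.
Proof. by rewrite -comp_lfunA phom_nat !comp_lfunA phom_nat. Qed.
Definition phom_comp M N P (g : phom N P) (f : phom M N) : phom M P :=
  PHom (phom_comp_nat g f).

Lemma phom_compE M N P (g : phom N P) (f : phom M N) s x :
  phom_comp g f s x = g s (f s x).
Proof. exact: comp_lfunE. Qed.

Fact phom_shift_nat M N (f : phom M N) (e : R) s t (st : ple s t) :
  (f (translate t e) \o pmor (pshift M e) st)%VF =
  (pmor (pshift N e) st \o f (translate s e))%VF.
Proof. exact: (phom_nat f (ple_translate e st)). Qed.
Definition phom_shift M N (f : phom M N) (e : R) :
  phom (pshift M e) (pshift N e) :=
  @PHom _ _ _ (pshift M e) (pshift N e) (fun s => f (translate s e))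
    (phom_shift_nat f e).

Lemma dsum_morE A B s t (st : ple s t) x :
  pmor (dsum A B) st x = (pmor A st x.1, pmor B st x.2).
Proof. by rewrite lfunE. Qed.

Section Biproduct.
Variables A B : pmod.

Fact in1_linear s : linear (fun x : A s => (x, 0) : dsum A B s).
Proof. by move=> a x y; congr pair; rewrite /= ?scaler0 ?addr0. Qed.
Fact in1_nat s t (st : ple s t) (x : A s) :
  (pmor A st x, 0) = pmor (dsum A B) st (x, 0).
Proof. by rewrite dsum_morE /= linear0. Qed.
Definition in1 : phom A (dsum A B) := mkphom in1_linear in1_nat.

Fact in2_linear s : linear (fun x : B s => (0, x) : dsum A B s).
Proof. by move=> a x y; congr pair; rewrite /= ?scaler0 ?addr0. Qed.
Fact in2_nat s t (st : ple s t) (x : B s) :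
  (0, pmor B st x) = pmor (dsum A B) st (0, x).
Proof. by rewrite dsum_morE /= linear0. Qed.
Definition in2 : phom B (dsum A B) := mkphom in2_linear in2_nat.

Fact pr1_linear s : linear (fun x : dsum A B s => x.1).
Proof. by []. Qed.
Fact pr1_nat s t (st : ple s t) (x : dsum A B s) :
  (pmor (dsum A B) st x).1 = pmor A st x.1.
Proof. by rewrite dsum_morE. Qed.
Definition pr1 : phom (dsum A B) A := mkphom pr1_linear pr1_nat.

Fact pr2_linear s : linear (fun x : dsum A B s => x.2).
Proof. by []. Qed.
Fact pr2_nat s t (st : ple s t) (x : dsum A B s) :
  (pmor (dsum A B) st x).2 = pmor B st x.2.
Proof. by rewrite dsum_morE. Qed.
Definition pr2 : phom (dsum A B) B := mkphom pr2_linear pr2_nat.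

Lemma in1E s x : in1 s x = (x, 0). Proof. exact: mkphomE. Qed.
Lemma in2E s x : in2 s x = (0, x). Proof. exact: mkphomE. Qed.
Lemma pr1E s x : pr1 s x = x.1. Proof. exact: mkphomE. Qed.
Lemma pr2E s x : pr2 s x = x.2. Proof. exact: mkphomE. Qed.

Lemma in_pr s x : in1 s (pr1 s x) + in2 s (pr2 s x) = x.
Proof.
rewrite in1E in2E pr1E pr2E; case: x => x y.
by congr pair; rewrite /= ?addr0 ?add0r.
Qed.

Section Copair.
Variables (C : pmod) (f : phom A C) (g : phom B C).

Fact copair_linear s : linear (fun x : dsum A B s => f s x.1 + g s x.2).
Proof. by move=> a x y; rewrite !linearP scalerDr addrACA. Qed.
Fact copair_nat s t (st : ple s t) (x : dsum A B s) :
  f t (pmor (dsum A B) st x).1 + g t (pmor (dsum A B) st x).2 =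
  pmor C st (f s x.1 + g s x.2).
Proof. by rewrite dsum_morE linearD !phomE. Qed.
Definition copair : phom (dsum A B) C := mkphom copair_linear copair_nat.

Lemma copairE s x : copair s x = f s x.1 + g s x.2.
Proof. exact: mkphomE. Qed.

End Copair.

End Biproduct.

Definition dsum_hom A B C D (f : phom A C) (g : phom B D) :
    phom (dsum A B) (dsum C D) :=
  copair (phom_comp (in1 C D) f) (phom_comp (in2 C D) g).

Lemma dsum_homE A B C D (f : phom A C) (g : phom B D) s x :
  dsum_hom f g s x = (f s x.1, g s x.2).
Proof.
rewrite copairE !phom_compE in1E in2E.
by congr pair; rewrite /= ?addr0 ?add0r.
Qed.

End Homs.

(** * Shifts, and interleavings as a relation with a triangle inequality *)

Section Interleaving.
Variables (R : realType) (k : fieldType) (n : nat).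
Local Notation pmod := (pmod R k n).
Implicit Types (M N P : pmod) (s t u : 'rV[R]_n) (e r : R).

Lemma translateA s e r : translate (translate s e) r = translate s (e + r).
Proof. by apply/rowP => j; rewrite !mxE addrA. Qed.

Lemma translate_ge s e : 0 <= e -> ple s (translate s e).
Proof. by move=> e0; apply/forallP => j; rewrite !mxE lerDl. Qed.

Section Unit.
Variables (M : pmod) (e : R) (e0 : 0 <= e).

Fact punit_nat s t (st : ple s t) :
  (pmor M (translate_ge t e0) \o pmor M st)%VF =
  (pmor (pshift M e) st \o pmor M (translate_ge s e0))%VF.
Proof.
by rewrite !(pmor_comp _ _ _ (ple_trans st (translate_ge t e0))).
Qed.
Definition punit : phom M (pshift M e) :=
  @PHom _ _ _ M (pshift M e) (fun s => pmor M (translate_ge s e0)) punit_nat.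

End Unit.

Section ShiftShift.
Variables (M : pmod) (e r c : R) (erc : e + r = c).

(** The two points are equal but not convertible, so the spaces of [M] at them have different types;
    the structure morphism between them stands for the identity. *)
Fact shift_shift_ple s :
  ple (translate (translate s e) r) (translate s c).
Proof. by rewrite translateA erc ple_refl. Qed.

Fact shift_shift_nat s t (st : ple s t) :
  (pmor M (shift_shift_ple t) \o pmor (pshift (pshift M r) e) st)%VF =
  (pmor (pshift M c) st \o pmor M (shift_shift_ple s))%VF.
Proof.
have h := ple_trans (shift_shift_ple s) (ple_translate c st).
by rewrite !(pmor_comp _ _ _ h).
Qed.
Definition shift_shift : phom (pshift (pshift M r) e) (pshift M c) :=
  @PHom _ _ _ (pshift (pshift M r) e) (pshift M c)
    (fun s => pmor M (shift_shift_ple s)) shift_shift_nat.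

End ShiftShift.

(** [N] and its shift by 0 are not convertible, so [punit] at 0 carries the isomorphism into the
    shift. *)
Lemma interleaved_iso M N : pmod_iso M N -> interleaved 0 M N.
Proof.
case=> f [g fg].
exists (phom_comp (punit N (lexx 0)) f), (phom_comp (punit M (lexx 0)) g).
move=> s h; have [/lfunP gf1 /lfunP fg1] := fg s.
split; apply/lfunP => x; rewrite /= !comp_lfunE phomE (pmorK _ _ h).
  by have := gf1 x; rewrite comp_lfunE lfunE => ->.
by have := fg1 x; rewrite comp_lfunE lfunE => ->.
Qed.

Lemma interleaved_sym e M N : interleaved e M N -> interleaved e N M.
Proof. by case=> f [g fg]; exists g, f => s h; have [] := fg s h. Qed.

Lemma interleaved_trans e r M N P : 0 <= e -> 0 <= r ->
  interleaved e M N -> interleaved r N P -> interleaved (e + r) M P.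
Proof.
move=> e0 r0 MN NP.
(* One of the two triangle identities, for arbitrary modules. The other one follows by exchanging
   the outer modules and the two parameters, which is why [c] is given as a sum in both orders. *)
have mid (a b c : R) (ba : b + a = c) (ab : a + b = c) (A B C : pmod)
    (f : phom A (pshift B a))
    (g : phom B (pshift A a)) (f' : phom B (pshift C b))
    (g' : phom C (pshift B b)) :
  0 <= a -> 0 <= b ->
  (forall s (h : ple s (translate (translate s a) a)),
     (g (translate s a) \o f s)%VF = pmor A h) ->
  (forall s (h : ple s (translate (translate s b) b)),
     (g' (translate s b) \o f' s)%VF = pmor B h) ->
  forall s (h : ple s (translate (translate s c) c)) x,
    phom_comp (shift_shift A ba) (phom_comp (phom_shift g b) g')
      (translate s c)
      (phom_comp (shift_shift C ab) (phom_comp (phom_shift f' a) f) s x) =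
    pmor A h x.
  move=> a0 b0 gf gf' s h x; rewrite /= !comp_lfunE.
  (* Naturality of [g'] moves the structure morphism out from between [f'] and [g'], so that this
     inner pair collapses; the pair [f], [g] then follows in the same way. *)
  rewrite (phomE g') /=.
  have h1 : ple (translate s a) (translate (translate (translate s a) b) b).
    exact: ple_trans (translate_ge (translate s a) b0) (translate_ge _ b0).
  have /lfunP/(_ (f s x)) := gf' _ h1.
  rewrite comp_lfunE => ->.
  have h2 := ple_trans h1 (ple_translate b (shift_shift_ple ab s)).
  rewrite (pmorK _ _ h2).
  rewrite (phomE g) /=.
  have h3 := ple_trans (translate_ge s a0) (translate_ge (translate s a) a0).
  have /lfunP/(_ x) := gf _ h3; rewrite comp_lfunE => ->.
  by rewrite (pmorK _ _ (ple_trans h3 (ple_translate a h2))) (pmorK _ _ h).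
case: MN => f [g fg]; case: NP => f' [g' fg'].
have re : r + e = e + r by rewrite addrC.
exists (phom_comp (shift_shift P erefl) (phom_comp (phom_shift f' e) f)).
exists (phom_comp (shift_shift M re) (phom_comp (phom_shift g r) g')).
move=> s h; split; apply/lfunP => x; rewrite comp_lfunE.
  by apply: mid => // u hu; [case: (fg u hu)|case: (fg' u hu)].
by apply: mid => // u hu; [case: (fg' u hu)|case: (fg u hu)].
Qed.

End Interleaving.

(** * The topology of the interleaving distance on isomorphism classes *)

Section DIntTopology.
Variables (R : realType) (k : fieldType) (n : nat).
Implicit Types (M N P : pmod R k n) (C D : fpspace R k n) (e r : R).

Lemma interleaved_iso_r e M N P : 0 <= e ->
  interleaved e M N -> pmod_iso N P -> interleaved e M P.
Proof.
move=> e0 MN NP; rewrite -[e]addr0.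
exact: interleaved_trans (interleaved_iso NP).
Qed.

Lemma pmod_iso_refl M : pmod_iso M M.
Proof.
by exists (phom1 M), (phom1 M) => s; rewrite /= comp_lfun1l.
Qed.

Lemma dI_ltP M N r :
  (dI M N < r%:E)%E <-> exists e, [/\ 0 <= e, e < r & interleaved e M N].
Proof.
split=> [/ereal_inf_lt[_ [e [e0 MN] <-]]|[e [e0 er MN]]].
  by rewrite lte_fin => er; exists e.
apply: (@le_lt_trans _ _ e%:E); last by rewrite lte_fin.
by apply: ereal_inf_lbound; exists e.
Qed.

Lemma representativeP C : class_of C (representative C).
Proof.
rewrite /representative; case: cid2 => M /= _ CM.
exact/CM/pmod_iso_refl.
Qed.

Lemma representative_fp C : fin_presentable (representative C).
Proof. by rewrite /representative; case: cid2. Qed.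

Lemma class_ball_center C r : 0 < r -> class_ball C r C.
Proof.
move=> r0; apply/dI_ltP; exists 0; split=> //.
exact/interleaved_iso/pmod_iso_refl.
Qed.

(** Induction on the generation of the topology. Around a point at interleaving [e < r] from the
    centre of a ball, the triangle inequality leaves the radius [r - e]; an intersection takes the
    smaller radius. *)
Lemma gen_open_ball (U : fpspace R k n -> Prop) C :
  gen_open (@open_balls R k n) U -> U C ->
  exists2 r, 0 < r & forall D, class_ball C r D -> U D.
Proof.
elim=> {U} [U [A [r [r0 ->]]] /dI_ltP[e [e0 er AC]]|_|
  U V _ IHU _ IHV [/IHU[r r0 rU] /IHV[e e0 eV]]|G _ IH [U GU /(IH U GU)]].
- exists (r - e); first by rewrite subr_gt0.
  move=> D /dI_ltP[a [a0 ar CD]]; apply/dI_ltP; exists (e + a); split.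
  + exact: addr_ge0.
  + by rewrite addrC -ltrBrDr.
  + exact: interleaved_trans CD.
- by exists 1.
- exists (Num.min r e); first by rewrite lt_min r0 e0.
  move=> D; rewrite /class_ball => /dI_ltP[a [a0]].
  rewrite lt_min => /andP[ar ae] CD.
  by split; [apply: rU|apply: eV]; apply/dI_ltP; exists a.
- by case=> r r0 rU; exists r => // D /rU UD; exists U.
Qed.

End DIntTopology.

(** * Pointwise cokernels of morphisms *)

Section Cokernel.
Variables (R : realType) (k : fieldType) (n : nat).
Local Notation pmod := (pmod R k n).
Implicit Types (s t u : 'rV[R]_n).

Section LinearCokernel.
Variables (V : vectType k) (L : {vspace V}).

(* [locked] prevents [comp_lfunE] from unfolding the projection. *)
Definition vcoker_proj : 'Hom(V, subvs_of L^C) :=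
  locked (linfun (vsproj L^C) \o (\1 - projv L))%VF.
Definition vcoker_sect : 'Hom(subvs_of L^C, V) := linfun vsval.

Lemma vcoker_projK x : vcoker_proj (vcoker_sect x) = x.
Proof.
rewrite /vcoker_proj -lock comp_lfunE add_lfunE opp_lfunE id_lfunE !lfunE /=.
have : vsval x \in lker (projv L) by rewrite lker_proj subvsP.
by rewrite memv_ker => /eqP ->; rewrite subr0 vsvalK.
Qed.

Lemma vcoker_proj_eq0 x : (vcoker_proj x == 0) = (x \in L).
Proof.
rewrite /vcoker_proj -lock comp_lfunE add_lfunE opp_lfunE id_lfunE lfunE /=.
apply/eqP/idP => [/(congr1 vsval)|xL]; last first.
  by rewrite projv_id // subrr linear0.
rewrite vsprojK ?memv_projC // linear0 => /eqP.
by rewrite subr_eq0 => /eqP ->; exact: memv_proj.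
Qed.

End LinearCokernel.

Variables (A B : pmod) (f : phom A B).

(** A complement of the image stands for the quotient; the quotient map is a projection whose kernel
    is the image. *)
Definition cok_obj s : vectType k := subvs_of (limg (f s))^C.
Definition cok_proj s : 'Hom(B s, cok_obj s) := vcoker_proj (limg (f s)).
Definition cok_sect s : 'Hom(cok_obj s, B s) := vcoker_sect (limg (f s)).
Definition cok_mor s t (st : ple s t) : 'Hom(cok_obj s, cok_obj t) :=
  (cok_proj t \o pmor B st \o cok_sect s)%VF.

Lemma cok_sectK s x : cok_proj s (cok_sect s x) = x.
Proof. exact: vcoker_projK. Qed.

Lemma cok_proj_eq0 s x : (cok_proj s x == 0) = (x \in limg (f s)).
Proof. exact: vcoker_proj_eq0. Qed.

(** The structure morphisms of [B] need not preserve the chosen complements. But projecting and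
    lifting back changes [x] only by an element of the image of [f], and naturality of [f] keeps
    this error in the image. *)
Lemma cok_mor_proj s t (st : ple s t) x :
  cok_mor st (cok_proj s x) = cok_proj t (pmor B st x).
Proof.
rewrite !comp_lfunE; apply/eqP; rewrite -subr_eq0 -!linearB cok_proj_eq0.
have /memv_imgP[y _ ->] : cok_sect s (cok_proj s x) - x \in limg (f s).
  by rewrite -cok_proj_eq0 linearB /= cok_sectK subrr.
by rewrite /= -(phomE f st) memv_img ?memvf.
Qed.

Fact cok_id s (h : ple s s) : cok_mor h = \1%VF.
Proof.
by apply/lfunP => x; rewrite !comp_lfunE pmor1 cok_sectK lfunE.
Qed.

Fact cok_comp s t u (st : ple s t) (tu : ple t u) (su : ple s u) :
  (cok_mor tu \o cok_mor st)%VF = cok_mor su.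
Proof.
apply/lfunP => x; rewrite [LHS]comp_lfunE -(cok_sectK x) !cok_mor_proj.
by rewrite (pmorK _ _ su).
Qed.

Definition cok : pmod := PMod cok_id cok_comp.

Fact cok_pi_nat s t (st : ple s t) :
  (cok_proj t \o pmor B st)%VF = (pmor cok st \o cok_proj s)%VF.
Proof.
apply/lfunP => x.
by rewrite [LHS]comp_lfunE [RHS]comp_lfunE /= cok_mor_proj. Qed.
Definition cok_pi : phom B cok := @PHom _ _ _ B cok cok_proj cok_pi_nat.

Lemma cok_pi_surj s (y : cok s) : exists x, y = cok_pi s x.
Proof. by exists (cok_sect s y); rewrite /= cok_sectK. Qed.

Lemma cok_pi_eq0 s x : (cok_pi s x == 0) = (x \in limg (f s)).
Proof. exact: cok_proj_eq0. Qed.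

Lemma cok_is_cokernel : is_cokernel f cok_pi.
Proof.
split=> [s|N q qf].
  apply/lfunP => x; rewrite comp_lfunE [RHS]lfunE /=; apply/eqP.
  by rewrite cok_proj_eq0 memv_img ?memvf.
(* Since [q] kills the image of [f], it does not see the choice of lift; hence [q] after the section
   is the induced map. *)
have qs s x : q s (cok_sect s (cok_proj s x)) = q s x.
  apply/eqP; rewrite -subr_eq0 -linearB /=.
  have /memv_imgP[y _ ->] : cok_sect s (cok_proj s x) - x \in limg (f s).
    by rewrite -cok_proj_eq0 linearB /= cok_sectK subrr.
  by have /lfunP/(_ y) := qf s; rewrite comp_lfunE lfunE => /= ->.
have h_nat s t (st : ple s t) :
    ((q t \o cok_sect t) \o pmor cok st = pmor N st \o (q s \o cok_sect s))%VF.
  apply/lfunP => x; rewrite [LHS]comp_lfunE [RHS]comp_lfunE.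
  rewrite -(cok_sectK x) cok_mor_proj !comp_lfunE.
  by rewrite !qs phomE.
exists (@PHom _ _ _ cok N _ h_nat); split=> [s|h' h'q s].
  by apply/lfunP => x; rewrite !comp_lfunE qs.
apply/lfunP => x; rewrite comp_lfunE -(cok_sectK x) qs.
by rewrite -h'q comp_lfunE.
Qed.

End Cokernel.

(** * Finite presentability of direct sums *)

Section FinitePresentation.
Variables (R : realType) (k : fieldType) (n : nat).
Local Notation pmod := (pmod R k n).
Implicit Types (A B C D M N P : pmod).

Lemma pmod_iso_sym M N : pmod_iso M N -> pmod_iso N M.
Proof. by case=> f [g fg]; exists g, f => s; have [] := fg s. Qed.

Lemma dsums_cat (l1 l2 : seq pmod) :
  pmod_iso (dsum (dsums l1) (dsums l2)) (dsums (l1 ++ l2)).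
Proof.
elim: l1 => [|A l1 [f [g fg]]] /=.
  exists (pr2 _ _), (in2 _ _) => s; split; apply/lfunP => x.
    rewrite comp_lfunE id_lfunE in2E pr2E; case: x => x y.
    by congr pair; rewrite [RHS]thinmx0.
  by rewrite comp_lfunE id_lfunE in2E pr2E.
pose f1 : phom (dsum A (dsums l1)) (dsum A (dsums (l1 ++ l2))) :=
  dsum_hom (phom1 A) (phom_comp f (in1 _ _)).
pose f2 := phom_comp (in2 A _) (phom_comp f (in2 (dsums l1) (dsums l2))).
pose g1 := phom_comp (in1 _ (dsums l2)) (in1 A (dsums l1)).
pose g2 := phom_comp (dsum_hom (in2 A (dsums l1)) (phom1 (dsums l2))) g.
exists (copair f1 f2), (copair g1 g2) => s.
have [/lfunP gf1 /lfunP fg1] := fg s; split; apply/lfunP => x.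
  rewrite comp_lfunE id_lfunE /f1 /f2 /g1 /g2.
  rewrite !(copairE, dsum_homE, in1E, in2E, phom_compE) /= !id_lfunE.
  case: x => [[a b] c] /=.
  have -> : f s (b, 0) + f s (0, c) = f s (b, c).
    rewrite -linearD; congr (f s _).
    by congr pair; rewrite /= ?addr0 ?add0r.
  have := gf1 (b, c); rewrite comp_lfunE id_lfunE /= => -> /=.
  by congr pair; [congr pair|]; rewrite /= !(addr0, add0r).
rewrite comp_lfunE id_lfunE /f1 /f2 /g1 /g2.
rewrite !(copairE, dsum_homE, in1E, in2E, phom_compE) /= !id_lfunE.
case: x => [a b] /=; congr pair; rewrite /= ?addr0 // -linearD.
have := fg1 b; rewrite comp_lfunE id_lfunE /= => e; rewrite -[RHS]e /=.
congr (f s _).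
by case: (g s b) => c d; congr pair; rewrite /= ?addr0 ?add0r.
Qed.

Lemma is_cokernel_dsum A B M (f : phom A B) (p : phom B M)
    C D N (g : phom C D) (q : phom D N) :
  is_cokernel f p -> is_cokernel g q ->
  is_cokernel (dsum_hom f g) (dsum_hom p q).
Proof.
move=> [pf puniv] [qg quniv]; split=> [s|P r rfg].
  apply/lfunP => x; rewrite comp_lfunE !dsum_homE zero_lfunE /=.
  have /lfunP/(_ x.1) := pf s; have /lfunP/(_ x.2) := qg s.
  by rewrite !comp_lfunE !zero_lfunE => -> ->.
case: (puniv P (phom_comp r (in1 B D))) => [s|h1 [h1p h1u]].
  apply/lfunP => x; have /lfunP/(_ (x, 0)) := rfg s.
  rewrite !comp_lfunE dsum_homE !zero_lfunE /= linear0 => <-.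
  by rewrite in1E.
case: (quniv P (phom_comp r (in2 B D))) => [s|h2 [h2q h2u]].
  apply/lfunP => x; have /lfunP/(_ (0, x)) := rfg s.
  rewrite !comp_lfunE dsum_homE !zero_lfunE /= linear0 => <-.
  by rewrite in2E.
exists (copair h1 h2); split=> [s|h' h'pq s].
  apply/lfunP => x; rewrite comp_lfunE dsum_homE copairE /=.
  have /lfunP/(_ x.1) := h1p s; have /lfunP/(_ x.2) := h2q s.
  rewrite !comp_lfunE => -> ->; rewrite -linearD -pr1E -pr2E.
  by rewrite in_pr.
have /lfunP e1 : phom_comp h' (in1 M N) s = h1 s.
  apply: h1u => u; apply/lfunP => y.
  have /lfunP/(_ (in1 B D u y)) := h'pq u.
  by rewrite !comp_lfunE dsum_homE !in1E /= linear0.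
have /lfunP e2 : phom_comp h' (in2 M N) s = h2 s.
  apply: h2u => u; apply/lfunP => y.
  have /lfunP/(_ (in2 B D u y)) := h'pq u.
  by rewrite !comp_lfunE dsum_homE !in2E /= linear0.
apply/lfunP => x; rewrite -[x in LHS]in_pr linearD copairE /=.
by rewrite -e1 -e2 !phom_compE pr1E pr2E.
Qed.

(** This moves a presentation to the free modules on concatenated lists. On the side of the
    relations a pointwise, possibly unnatural, right inverse is enough, because precomposition with
    a surjection does not change a cokernel. *)
Lemma is_cokernel_iso A B M (f : phom A B) (p : phom B M) A' B'
    (a : phom A' A) (b : phom B B') (b' : phom B' B) :
  (forall s, exists a' : 'Hom(A s, A' s), (a s \o a' = \1)%VF) ->
  (forall s, (b' s \o b s = \1)%VF /\ (b s \o b' s = \1)%VF) ->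
  is_cokernel f p ->
  is_cokernel (phom_comp b (phom_comp f a)) (phom_comp p b').
Proof.
move=> aa' bb' [pf univ]; split=> [s|N q qf] /=.
  have [b'b _] := bb' s.
  by rewrite -!comp_lfunA (comp_lfunA (b' s)) b'b comp_lfun1l comp_lfunA pf
             comp_lfun0l.
case: (univ N (phom_comp q b)) => [s|h [hp hu]] /=.
  have [a' aa1] := aa' s; have := qf s; rewrite /= => e.
  by rewrite -[RHS](comp_lfun0l _ a') -e -!comp_lfunA aa1 comp_lfun1r.
exists h; split=> [s|h' h'q s].
  by rewrite comp_lfunA hp /= -comp_lfunA (bb' s).2 comp_lfun1r.
apply: hu => {}s; rewrite /= -h'q /= -!comp_lfunA.
by rewrite (bb' s).1 comp_lfun1r.
Qed.

Lemma fin_presentable_dsum M N :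
  fin_presentable M -> fin_presentable N -> fin_presentable (dsum M N).
Proof.
move=> [I [J [f [p fp]]]] [I' [J' [g [q gq]]]].
have [b [b' bb']] := dsums_cat [seq pfree k i | i <- I]
  [seq pfree k i | i <- I'].
have [a' [a aa']] := dsums_cat [seq pfree k i | i <- J]
  [seq pfree k i | i <- J'].
exists (I ++ I'), (J ++ J'); rewrite !map_cat.
do 2 eexists; apply: (is_cokernel_iso (a := a) (b := b) (b' := b')).
- by move=> s; exists (a' s); have [] := aa' s.
- by [].
- exact: is_cokernel_dsum fp gq.
Qed.

End FinitePresentation.

(** * Coordinates on finite free modules *)

Section FreeCoordinates.
Variables (R : realType) (k : fieldType) (n : nat).
Implicit Types (I : seq 'rV[R]_n) (s t : 'rV[R]_n) (a : nat -> k).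
Local Notation free I := (dsums [seq pfree k i | i <- I]).

(* The only entry of a row of length 1, and 0 for the empty row. *)
Definition mass (b : bool) (x : 'rV[k]_b) : k := \sum_l x 0 l.

Lemma mass_linear (b : bool) (c : k) (x y : 'rV[k]_b) :
  mass (c *: x + y) = c * mass x + mass y.
Proof.
by rewrite /mass mulr_sumr -big_split; apply: eq_bigr => l _; rewrite !mxE.
Qed.

Lemma mass_const (b : bool) c :
  mass (const_mx c : 'rV[k]_b) = if b then c else 0.
Proof. by rewrite /mass; case: b; rewrite ?big_ord0 ?big_ord1 ?mxE. Qed.

Lemma mass_inj (b : bool) (x y : 'rV[k]_b) :
  (b -> mass x = mass y) -> x = y.
Proof.
case: b x y => x y; last by rewrite [x]thinmx0 [y]thinmx0.
by rewrite /mass !big_ord1 => /(_ isT) xy; apply/rowP => l; rewrite !ord1.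
Qed.

Lemma mass_dead (b : bool) (x : 'rV[k]_b) : ~~ b -> mass x = 0.
Proof. by rewrite /mass; case: b x => // x _; rewrite big_ord0. Qed.

Lemma mass_mul (b c : bool) (x : 'rV[k]_b) : (b -> c) ->
  mass (x *m const_mx 1 : 'rV[k]_c) = mass x.
Proof.
rewrite /mass; case: b x => x; last first.
  by rewrite big_ord0 big1 // => l _; rewrite [x]thinmx0 mul0mx mxE.
by move=> /(_ isT) ->; rewrite !big_ord1 mxE big_ord1 mxE mulr1.
Qed.

(** Scalars are indexed by [nat], with value 0 out of range and at generators not below [s], so that
    vectors at different points of the poset can be compared directly. *)
Fixpoint coord I s : free I s -> nat -> k :=
  match I with
  | [::] => fun _ _ => 0
  | i :: I' => fun x j =>
      if j is j'.+1 then coord (I := I') x.2 j' else mass (b := ple i s) x.1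
  end.

(** Scalars prescribed at generators not below [s] are lost, since [const_mx] then has no entry. *)
Fixpoint fvec I s a : free I s :=
  match I with
  | [::] => 0
  | i :: I' => (const_mx (a 0), fvec I' s (a \o S))
  end.

Definition alive I s j : bool := (j < size I)%N && ple (nth 0 I j) s.

Lemma alive_nseq m i s j : alive (nseq m i) s j = (j < m)%N && ple i s.
Proof. by rewrite /alive size_nseq nth_nseq; case: ltnP. Qed.

Lemma coord_linear I s (c : k) (x y : free I s) j :
  coord (c *: x + y) j = c * coord x j + coord y j.
Proof.
elim: I j x y => [|i I IH] [|j] x y /=; rewrite ?mulr0 ?addr0 ?IH //.
exact: mass_linear.
Qed.

Lemma coord0 I s j : coord (0 : free I s) j = 0.
Proof.
by have := coord_linear (-1) 0 (0 : free I s) j;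
   rewrite scaleN1r oppr0 addr0 mulN1r addNr.
Qed.

Lemma coordZ I s (c : k) (x : free I s) j : coord (c *: x) j = c * coord x j.
Proof. by rewrite -[c *: x]addr0 coord_linear coord0 addr0. Qed.

Lemma coordD I s (x y : free I s) j : coord (x + y) j = coord x j + coord y j.
Proof. by rewrite -[x]scale1r coord_linear mul1r scale1r. Qed.

Lemma coord_sum I s (S : finType) (F : S -> free I s) j :
  coord (\sum_i F i) j = \sum_i coord (F i) j.
Proof.
apply: (big_morph (fun x => coord x j)); last exact: coord0.
by move=> x y; exact: coordD.
Qed.

Lemma coord_fvec I s a j :
  coord (fvec I s a) j = if alive I s j then a j else 0.
Proof.
by elim: I j a => [|i I IH] [|j] a //=; [exact: mass_const|rewrite IH].
Qed.

Lemma coord_inj I s (x y : free I s) :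
  (forall j, alive I s j -> coord x j = coord y j) -> x = y.
Proof.
elim: I x y => [|i I IH] x y xy; first by rewrite [x]thinmx0 [y]thinmx0.
case: x y xy => x x' [y y'] xy; congr pair; last first.
  by apply: IH => j /(xy j.+1).
have := xy 0; rewrite /alive /= => {}xy.
exact: mass_inj xy.
Qed.

Lemma coord_dead I s (x : free I s) j : ~~ alive I s j -> coord x j = 0.
Proof.
elim: I j x => [|i I IH] [|j] //= x; last by move/IH.
by rewrite /alive /= => nis; apply: mass_dead.
Qed.

(** No condition on [j] is needed: a generator not yet present at [s] has coordinate 0 in [x], and
    the structure morphism does not create it. *)
Lemma coord_pmor I s t (st : ple s t) (x : free I s) j :
  coord (pmor (free I) st x) j = coord x j.
Proof.
elim: I j x => [|i I IH] j x //.
have -> : pmor (free (i :: I)) st x =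
    (pmor (pfree k i) st x.1, pmor (free I) st x.2) by exact: dsum_morE.
case: j => [|j] //=; rewrite lfunE /=.
by apply: mass_mul => is_; apply: (ple_trans is_ st).
Qed.

Lemma dim_free I s : (forall j, (j < size I)%N -> ple (nth 0 I j) s) ->
  \dim {:free I s} = size I.
Proof.
rewrite dimvf; elim: I => [|i I IH] Is; first by rewrite dim_matrix.
have -> : dim (free (i :: I) s) =
    (dim 'rV[k]_(ple i s) + dim (free I s))%N by [].
rewrite IH => [|j jI]; last exact: (Is j.+1).
by rewrite dim_matrix (Is 0%N).
Qed.

End FreeCoordinates.

(** * The star module and its morphisms to its own shifts *)

Section StarModule.
Variables (R : realType) (k : fieldType) (n : nat).
Variables (I : seq 'rV[R]_n) (p c : 'rV[R]_n).
Hypothesis Ip : forall j, (j < size I)%N -> ple (nth 0 I j) p.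
Hypothesis pc : ple p c.
Implicit Types (s t : 'rV[R]_n).
Local Notation free I := (dsums [seq pfree k i | i <- I]).
Local Notation J := (p :: nseq (size I) c).

Lemma alive_rel s j : alive J s j.+1 = (j < size I)%N && ple c s.
Proof. exact: alive_nseq. Qed.

(* Relation 0 is the sum of all generators, imposed at p; relation j.+1 is
   generator j, imposed at c. *)
Definition star_rel_fun s (x : free J s) : free I s :=
  fvec I s (fun j => coord x 0 + coord x j.+1).

(** Only the range of [j] is tested: where generator [j] is absent, so are the relations at [p] and
    [c], which lie above it, and their coordinates are 0. *)
Lemma coord_star_rel s (x : free J s) j :
  coord (star_rel_fun x) j =
  if (j < size I)%N then coord x 0 + coord x j.+1 else 0.
Proof.
rewrite coord_fvec /alive; case: ltnP => // jI; rewrite andTb.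
case: ifP => // /negP Ijs; rewrite [coord x 0]coord_dead ?add0r.
  rewrite [RHS]coord_dead //; apply/negP; rewrite alive_rel jI => cs.
  exact/Ijs/(ple_trans _ cs)/(ple_trans _ pc)/Ip.
by apply/negP => ps; apply: Ijs; apply: ple_trans (Ip jI) ps.
Qed.

Fact star_rel_linear s : linear (@star_rel_fun s).
Proof.
move=> a x y; apply: coord_inj => j _.
rewrite coord_linear !coord_star_rel; case: ifP => _; last first.
  by rewrite mulr0 addr0.
by rewrite !coord_linear mulrDr addrACA.
Qed.

Fact star_rel_nat s t (st : ple s t) (x : free J s) :
  star_rel_fun (pmor (free J) st x) = pmor (free I) st (star_rel_fun x).
Proof.
by apply: coord_inj => j _; rewrite coord_pmor !coord_star_rel !coord_pmor.
Qed.

Definition star_rel : phom (free J) (free I) :=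
  mkphom star_rel_linear star_rel_nat.

Definition star : pmod R k n := cok star_rel.

Local Notation pi := (cok_pi star_rel).

Lemma star_fp : fin_presentable star.
Proof. by exists I, J, star_rel, pi; apply: cok_is_cokernel. Qed.

Lemma star_eq0 s : (forall j, (j < size I)%N -> ~~ ple (nth 0 I j) s) ->
  forall x : star s, x = 0.
Proof.
move=> Is x; have [y ->] := cok_pi_surj x.
suff -> : y = 0 by rewrite linear0.
by apply: coord_inj => j /andP[jI /(negP (Is j jI))].
Qed.

Lemma star_dead s : ple c s -> forall x : star s, x = 0.
Proof.
move=> cs x; have [y ->] := cok_pi_surj x; apply/eqP; rewrite cok_pi_eq0.
(* The relations at [c] alone produce [y]: relation [j.+1] takes the coefficient of generator [j],
   and relation 0 takes 0. *)
pose z := fvec J s (fun j => if j is j'.+1 then coord y j' else 0).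
suff -> : y = star_rel s z by rewrite memv_img ?memvf.
apply: coord_inj => j /andP[jI _]; rewrite mkphomE coord_star_rel jI.
by rewrite !coord_fvec if_same add0r alive_rel jI cs.
Qed.

(** At such a point all generators and relation 0 are present but no relation at [c] is, so the
    image of [star_rel] is the diagonal line. *)
Lemma star_pi_eq0 s (ps : ple p s) (cs : ~~ ple c s) (y : free I s) :
  pi s y = 0 <-> exists mu, forall j, (j < size I)%N -> coord y j = mu.
Proof.
split=> [/eqP|[mu ymu]].
  rewrite cok_pi_eq0 => /memv_imgP[z _ ->]; exists (coord z 0) => j jI.
  rewrite mkphomE coord_star_rel jI (@coord_dead _ _ _ _ _ _ j.+1) ?addr0 //.
  by rewrite alive_rel jI.
apply/eqP; rewrite cok_pi_eq0.
pose z := fvec J s (fun j => if j is 0%N then mu else 0).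
suff -> : y = star_rel s z by rewrite memv_img ?memvf.
apply: coord_inj => j /andP[jI _]; rewrite mkphomE coord_star_rel jI.
by rewrite !coord_fvec if_same addr0 /alive /= ps ymu.
Qed.

Section ShiftedEndomorphisms.
Variable e : R.
Hypothesis e0 : 0 <= e.
Let shift2 s := translate (translate s e) e.
Hypothesis antichain : forall i j, (i < size I)%N -> (j < size I)%N ->
  ple (nth 0 I j) (shift2 (nth 0 I i)) -> i = j.
Hypothesis c_far : ~~ ple c (shift2 p).

Let p_shift : ple p (shift2 p).
Proof. exact: ple_trans (translate_ge p e0) (translate_ge _ e0). Qed.

Let c_p : ~~ ple c p.
Proof. by apply: contra c_far => cp; apply: ple_trans cp p_shift. Qed.

(** After composition with the projection from the free module, the kernel lies in the diagonal line
    by [star_pi_eq0] at the shifted point, so rank-nullity loses at most 1. *)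
Lemma star_rank : ((size I).-1 <= \dim (limg (pmor star p_shift)))%N.
Proof.
pose g := (pmor star p_shift \o pi p)%VF.
have gI : (limg g <= limg (pmor star p_shift))%VS.
  by rewrite limg_comp limgS ?subvf.
apply: leq_trans (dimvS gI).
have := limg_ker_dim g fullv; rewrite capfv dim_free // => <-.
have : (lker g <= <[fvec I p (fun=> 1)]>)%VS.
  apply/subvP => y; rewrite memv_ker comp_lfunE -phomE => /eqP.
  case/(star_pi_eq0 p_shift c_far) => mu ymu.
  apply/vlineP; exists mu; apply: coord_inj => j jI.
  rewrite coordZ coord_fvec jI mulr1 -(coord_pmor p_shift) ymu //.
  by case/andP: jI.
move=> /dimvS; rewrite dim_vline => kg.
by rewrite -subn1 leq_subLR leq_add2r (leq_trans kg) ?leq_b1.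
Qed.

Lemma star_local (phi : phom star (pshift (pshift star e) e)) :
  exists lam : k, phi p = lam *: pmor star p_shift.
Proof.
pose q j := nth 0 I j.
(* Generator [j] at the point [q j] where it is born; the images of these elements determine [phi]
   at [p]. *)
pose b j := fvec I (q j) (fun i => (i == j)%:R : k).
have y_ex j : exists y : free I (shift2 (q j)),
    phi (q j) (pi (q j) (b j)) = pi (shift2 (q j)) y by exact: cok_pi_surj.
pose y j := projT1 (cid (y_ex j)).
have yP j : phi (q j) (pi (q j) (b j)) = pi (shift2 (q j)) (y j).
  exact: projT2 (cid (y_ex j)).
pose lam j := coord (y j) j.
(* By the antichain hypothesis no other generator is present at [shift2 (q j)], so [y j] is [lam j]
   times generator [j]. *)
have y_coord j i : (j < size I)%N ->
    coord (y j) i = if i == j then lam j else 0.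
  move=> jI; case: eqP => [->//|/eqP ij]; apply: coord_dead.
  apply: contra ij => /andP[iI /(antichain jI iI) ->//].
(* Naturality from each [q j] up to [p] shows that [phi p] lifts to the diagonal map with entries
   [lam j]. *)
have phiE (x : free I p) :
    phi p (pi p x) =
      pi (shift2 p) (fvec I (shift2 p) (fun j => coord x j * lam j)).
  have xE : x = \sum_(j < size I)
      coord x j *: pmor (free I) (Ip (ltn_ord j)) (b j).
    apply: coord_inj => j /andP[jI _].
    rewrite coord_sum (bigD1 (Ordinal jI)) //= big1 => [|i ij].
      rewrite addr0 coordZ coord_pmor coord_fvec.
      by rewrite /alive jI ple_refl eqxx mulr1.
    rewrite coordZ coord_pmor coord_fvec; case: ifP; rewrite ?mulr0 //.
    by move: ij; rewrite -val_eqE /= eq_sym => /negbTE ->; rewrite mulr0.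
  rewrite {1}xE !linear_sum /=.
  pose h j (jI : (j < size I)%N) : ple (shift2 (q j)) (shift2 p) :=
    ple_translate e (ple_translate e (Ip jI)).
  transitivity (pi (shift2 p) (\sum_(j < size I)
      coord x j *: pmor (free I) (h j (ltn_ord j)) (y j))).
    rewrite linear_sum; apply: eq_bigr => j _; rewrite !linearZ /=.
    by rewrite (phomE pi) (phomE phi) yP (phomE pi).
  congr (pi _ _); apply: coord_inj => j jal; rewrite coord_fvec jal.
  case/andP: jal => jI _.
  rewrite coord_sum (bigD1 (Ordinal jI)) //= big1 => [|i ij].
    by rewrite addr0 coordZ coord_pmor y_coord ?eqxx.
  rewrite coordZ coord_pmor y_coord //.
  by move: ij; rewrite -val_eqE /= eq_sym => /negbTE ->; rewrite mulr0.
(* The sum of the generators is 0 in the star module at [p]. Its image is represented by the vector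
   [lam], which therefore lies in the kernel of the projection at [shift2 p] and is constant. *)
have [lam0 lamE] : exists mu, forall j, (j < size I)%N -> lam j = mu.
  have : pi (shift2 p) (fvec I (shift2 p) lam) = 0.
    have := phiE (fvec I p (fun=> 1)).
    rewrite (_ : pi p _ = 0) ?linear0 => [->|]; last first.
      apply/(star_pi_eq0 (ple_refl p) c_p); exists 1 => j jI.
      by rewrite coord_fvec /alive jI Ip.
    congr (pi _ _); apply: coord_inj => j jal; rewrite !coord_fvec jal.
    by case/andP: jal => jI _; rewrite /alive jI Ip // mul1r.
  move/(star_pi_eq0 p_shift c_far) => [mu muP]; exists mu => j jI.
  by rewrite -(muP j jI) coord_fvec /alive jI (ple_trans (Ip jI) p_shift).
exists lam0; apply/lfunP => z; have [x ->] := cok_pi_surj z.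
rewrite scale_lfunE -(phomE pi) phiE -linearZ; congr (pi _ _).
apply: coord_inj => j jI; rewrite coordZ coord_fvec jI coord_pmor.
by case/andP: jI => jI _; rewrite lamE // mulrC.
Qed.

End ShiftedEndomorphisms.
End StarModule.

(** * Composites through sums of modules of small dimension *)

Section NoSmallSummands.
Variables (R : realType) (k : fieldType) (n : nat).
Variables (X : pmod R k n) (e : R) (p : 'rV[R]_n).
Variable h : ple p (translate (translate p e) e).
Hypothesis X_local : forall phi : phom X (pshift (pshift X e) e),
  exists lam : k, phi p = lam *: pmor X h.

(** Induction over the summands: the composite is the sum of the one through the head and the one
    through the tail, and the morphisms restricted to the tail are again an instance of the
    statement. *)
Lemma small_summands_vanish (l : seq (pmod R k n))
    (f : phom X (pshift (dsums l) e)) (g : phom (dsums l) (pshift X e)) :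
  (forall i, (i < size l)%N ->
     (pdim (nth (pzero R k n) l i) (translate p e) <
       \dim (limg (pmor X h)))%N) ->
  (g (translate p e) \o f p = 0)%VF.
Proof.
elim: l f g => [|A l IH] f g lX.
  by apply/lfunP => x; rewrite comp_lfunE (thinmx0 (f p x)) linear0 lfunE.
pose fA := phom_comp (phom_shift (pr1 A (dsums l)) e) f.
pose fl := phom_comp (phom_shift (pr2 A (dsums l)) e) f.
pose gA := phom_comp g (in1 A (dsums l)).
pose gl := phom_comp g (in2 A (dsums l)).
have gf0 : (gl (translate p e) \o fl p = 0)%VF.
  by apply: IH => i; exact: (lX i.+1).
have gfA : (gA (translate p e) \o fA p = 0)%VF.
  have [lam] := X_local (phom_comp (phom_shift gA e) fA).
  rewrite /= => gfA; rewrite gfA; have [->|lam0] := eqVneq lam 0.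
    by rewrite scale0r.
  have := lX 0%N isT; rewrite ltnNge => /negP[].
  have limg_le (V W : vectType k) (u : 'Hom(V, W)) (S : {vspace V}) :
      (\dim (u @: S) <= \dim S)%N.
    by rewrite -(limg_ker_dim u S) leq_addl.
  (* For [lam] non-zero, dividing by it shows that the composite reaches the whole image of the
     structure morphism, although it factors through the smaller space of [A] at [translate p e]. *)
  have /dimvS/leq_trans -> // :
      (limg (pmor X h) <= limg (gA (translate p e) \o fA p))%VS.
    apply/subvP => _ /memv_imgP[y _ ->].
    rewrite [X in limg X]gfA (_ : _ y = (lam *: pmor X h) (lam^-1 *: y)).
      by rewrite memv_img ?memvf.
    by rewrite scale_lfunE linearZ /= scalerA divff // scale1r.
  rewrite limg_comp (leq_trans (limg_le _ _ _ _)) // /pdim.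
  exact: dimvS (subvf _).
apply/lfunP => x; rewrite comp_lfunE -[f p x]in_pr linearD zero_lfunE.
have /lfunP/(_ x) := gf0; have /lfunP/(_ x) := gfA.
rewrite !comp_lfunE !zero_lfunE => gfAx gfx.
by rewrite -[RHS]addr0; congr (_ + _); [exact: gfAx|exact: gfx].
Qed.

End NoSmallSummands.

(** * A staircase antichain with gaps of size d *)

Section Staircase.
Variables (R : realType) (n D : nat) (d : R).
Hypotheses (hn : (2 <= n)%N) (d0 : 0 < d).

(** Coordinate 0 grows with [i] and all others decrease, in steps of [d]; as [n] is at least 2, both
    kinds of coordinate occur, which makes the points incomparable. *)
Definition stair (i : nat) : 'rV[R]_n :=
  \row_j (d * (if (j : nat) == 0%N then i%:R else (D.+1 - i)%:R)).
Definition stairs := mkseq stair D.+2.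
Definition stair_top : 'rV[R]_n := const_mx (d * D.+1%:R).
Definition stair_end : 'rV[R]_n := const_mx (d * D.+2%:R).

Lemma size_stairs : size stairs = D.+2.
Proof. by rewrite size_mkseq. Qed.

Lemma nth_stairs i : (i < size stairs)%N -> nth 0 stairs i = stair i.
Proof. by rewrite size_stairs => iD; rewrite nth_mkseq. Qed.

Lemma stairs_top i : (i < size stairs)%N -> ple (nth 0 stairs i) stair_top.
Proof.
move=> iD; rewrite nth_stairs //; move: iD; rewrite size_stairs => iD.
apply/forallP => j; rewrite !mxE ler_pM2l //.
by case: ifP => _; rewrite ler_nat // leq_subr.
Qed.

Lemma top_end : ple stair_top stair_end.
Proof. by apply/forallP => j; rewrite !mxE ler_pM2l // ler_nat. Qed.

(** For [i < j] coordinate 0 is violated, and for [j < i] coordinate 1: in each case the gap is at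
    least [d], more than the total shift. *)
Lemma stairs_antichain e i j : e + e < d ->
  (i < size stairs)%N -> (j < size stairs)%N ->
  ple (nth 0 stairs j) (translate (translate (nth 0 stairs i) e) e) -> i = j.
Proof.
move=> ed iD jD; rewrite !nth_stairs // => /forallP ple_ji.
pose j0 : 'I_n := Ordinal (ltnW hn); pose j1 : 'I_n := Ordinal hn.
move: iD jD; rewrite !size_stairs !ltnS => iD jD.
have step (a b : nat) : (a < b)%N -> ~~ (d * b%:R <= d * a%:R + e + e).
  move=> ab; rewrite -ltNge -addrA; apply: (@lt_le_trans _ _ (d * a.+1%:R)).
    by rewrite -natr1 mulrDr mulr1 ltrD2l.
  by rewrite ler_pM2l // ler_nat.
have := ple_ji j0; have := ple_ji j1; rewrite !mxE /= => le1 le0.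
case: (ltngtP i j) => // ij; first by have := step _ _ ij; rewrite le0.
by have := step _ _ (ltn_sub2l (leq_trans ij iD) ij); rewrite le1.
Qed.

Lemma end_far e : e + e < d ->
  ~~ ple stair_end (translate (translate stair_top e) e).
Proof.
move=> ed; apply/forallPn; exists (Ordinal (ltnW hn)).
rewrite !mxE -ltNge -addrA -[in ltRHS]natr1 mulrDr mulr1 ltrD2l //.
Qed.

(** The stairs have non-negative coordinates, so a shift by the coordinate [d * D.+2%:R] of
    [stair_end] already passes that point. *)
Lemma stairs_end r s i : d * D.+2%:R <= r -> (i < size stairs)%N ->
  ple (nth 0 stairs i) s -> ple stair_end (translate s r).
Proof.
move=> dr iD; rewrite nth_stairs // => /forallP is_; apply/forallP => j.
rewrite !mxE; apply: le_trans dr _; rewrite lerDr; apply: le_trans (is_ j).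
by rewrite !mxE; case: ifP => _; rewrite mulr_ge0 ?ler0n // ltW.
Qed.

End Staircase.

(** * Perturbation by a small summand, and nowhere density *)

Lemma interleaved_dsum_small (R : realType) (k : fieldType) (n : nat)
    (M X : pmod R k n) (e : R) : 0 <= e ->
  (forall s (h : ple s (translate (translate s e) e)) (x : X s),
     pmor X h x = 0) ->
  interleaved e M (dsum M X).
Proof.
move=> e0 X0.
(* Inclusion and projection, each combined with a structure morphism of [M]; the round trip on the
   sum is 0 on [X], as is the structure morphism there. *)
exists (phom_comp (phom_shift (in1 M X) e) (punit M e0)).
exists (phom_comp (punit M e0) (pr1 M X)) => s h; split; apply/lfunP => x.
  by rewrite !comp_lfunE /= in1E pr1E (pmorK _ _ h).
by rewrite !comp_lfunE /= in1E pr1E (pmorK _ _ h) dsum_morE X0.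
Qed.

(** Restricting an interleaving to the summand [X] factors its structure morphism at [p] through the
    sum of [l]; this composite vanishes, against the positive rank. *)
Lemma dsum_far (R : realType) (k : fieldType) (n : nat)
    (M X : pmod R k n) (e : R) (p : 'rV[R]_n)
    (h : ple p (translate (translate p e) e)) (l : seq (pmod R k n)) :
  (forall phi : phom X (pshift (pshift X e) e),
     exists lam : k, phi p = lam *: pmor X h) ->
  (forall i, (i < size l)%N ->
     (pdim (nth (pzero R k n) l i) (translate p e) <
       \dim (limg (pmor X h)))%N) ->
  (0 < \dim (limg (pmor X h)))%N ->
  ~ interleaved e (dsum M X) (dsums l).
Proof.
move=> X_local lX X0 [f [g fg]].
have gf0 := small_summands_vanish X_local (phom_comp f (in2 M X))
  (phom_comp (phom_shift (pr2 M X) e) g) lX.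
move: X0; rewrite (_ : pmor X h = 0).
  suff -> : limg (0 : 'Hom(X p, X (translate (translate p e) e))) = 0%VS.
    by rewrite dimv0.
  apply/eqP; rewrite -lkerE; apply/subvP => x _.
  by rewrite memv_ker zero_lfunE.
rewrite -gf0; apply/lfunP => x; rewrite !comp_lfunE /=.
have [/lfunP/(_ (in2 M X p x)) + _] := fg p h; rewrite comp_lfunE => ->.
by rewrite pr2E dsum_morE in2E.
Qed.

Section ClassOf.
Variables (R : realType) (k : fieldType) (n : nat).
Fact fpclass_proof (M : pmod R k n) (MP : fin_presentable M) :
  exists2 N, fin_presentable N & forall P, pmod_iso M P <-> pmod_iso N P.
Proof. by exists M. Qed.
Definition fpclass (M : pmod R k n) (MP : fin_presentable M) : fpspace R k n :=
  FPSpace (fpclass_proof MP).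
End ClassOf.

Theorem corollary1p4 (R : realType) (k : fieldType) (n : nat) (hn : (2 <= n)%N)
    (F : fpspace R k n -> Prop)
    (F_indec : forall C, F C -> forall N, class_of C N -> indecomposable N)
    (F_bounded : exists D : nat, forall C, F C ->
       forall N, class_of C N -> forall r : 'rV[R]_n, (pdim N r <= D)%N) :
  nowhere_dense (@open_balls R k n)
    (fun C : fpspace R k n => forall M, class_of C M -> fam_decomposable F M).
Proof.
case: F_bounded => D FD C [U [Uopen UC Uclos]].
have [r r0 rU] := gen_open_ball Uopen UC.
set M := representative C.
(* The choice [e < r] keeps the perturbed module in the ball, and [d * D.+2%:R = e] makes each
   generator die within a shift of [e]. *)
pose e := r / 2; have e0 : 0 < e by rewrite divr_gt0.
pose d := e / D.+2%:R; have d0 : 0 < d by rewrite divr_gt0.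
have Ip := @stairs_top R n D d d0; have pc := @top_end R n D d d0.
pose X := star k Ip pc.
pose MX_fp := fin_presentable_dsum (representative_fp C) (star_fp k Ip pc).
pose E := fpclass MX_fp.
have isoE : pmod_iso (dsum M X) (representative E).
  exact: (representativeP E).
have X_small s (h : ple s (translate (translate s e) e)) (x : X s) :
    pmor X h x = 0.
  (* Above some generator, the shift by [e + e] passes the end of the staircase, where [X] is 0;
     elsewhere [X s] itself is 0. *)
  have [[i iD is_]|no_i] := pselect (exists2 i, (i < size (stairs n D d))%N &
      ple (nth 0 (stairs n D d) i) s).
    apply: star_dead; rewrite translateA.
    apply: stairs_end iD is_ => //.
    by rewrite /d mulfVK ?pnatr_eq0 // lerDl ltW.
  rewrite (_ : x = 0) ?linear0 //; apply: star_eq0 => i iD.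
  by apply/negP => is_; apply: no_i; exists i.
have CE : class_ball C r E.
  apply/dI_ltP; exists e; split; first exact: ltW.
    by rewrite /e ltr_pdivrMr // ltr_pMr // ltr1n.
  apply: interleaved_iso_r isoE; first exact: ltW.
  exact: interleaved_dsum_small (ltW e0) X_small.
(* Radius [d / 2] ensures that any interleaving parameter [a] in this ball has [a + a < d], as the
   antichain and [end_far] require. *)
have ball_open : gen_open (@open_balls R k n) (class_ball E (d / 2)).
  by apply: gen_open_sub; exists E, (d / 2); rewrite divr_gt0.
have [|G EG SG] := Uclos E (rU E CE) _ ball_open.
  by apply: class_ball_center; rewrite divr_gt0.
have [l [lF lG]] := SG _ (representativeP G).
move/dI_ltP: EG => [a [a0 ad EG]].
have MXl : interleaved a (dsum M X) (dsums l).
  apply: interleaved_iso_r lG => //; apply: interleaved_sym.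
  apply: interleaved_iso_r (pmod_iso_sym isoE) => //.
  exact: interleaved_sym.
have aad : a + a < d by rewrite [d]splitr ltrD.
have anti i j := @stairs_antichain R n D d hn d0 a i j aad.
have far := end_far D hn aad.
(* The [D.+2] generators give rank at least [D.+1], one more than the bound on the summands. *)
have rk := star_rank k Ip pc a0 far; rewrite size_stairs /= in rk.
apply: (dsum_far (star_local a0 anti far) _ _ MXl) => [i il|].
  apply: leq_ltn_trans rk; have [K FK Kl] := lF i il; exact: FD Kl _.
exact: leq_trans rk.
Qed.
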